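(* Let $\phi_1(x)\equiv 1$, and let $f_d^*\in\operatorname{argmin}_{f\in\mathcal M_d}L(f)$. Define $\tilde y_i:=y_i-f_d^*(x_i)$ for $i=1,\dots,n$ and $\tilde y:=(\tilde y_1,\dots,\tilde y_n)$. Assume that the random vector $\tilde y$ and the random matrix $\Phi$ are statistically independent. (No orthonormality of $\phi_1,\dots,\phi_d$ is assumed.) Then the ratio $$T^*(n,d):=\frac{E_D[L(f_d(\cdot;\hat\alpha(D)))]}{E_D[L_D(f_d(\cdot;\hat\alpha(D)))]}$$ is exactly $$T^*(n,d)=\frac{1+(1/n)\,E_D[\operatorname{Tr}(C\widehat C^{-1})]}{1-(d/n)},$$ where $C=[C_{kk'}]$ is the $d\times d$ matrix with $C_{kk'}:=E_x[\phi_k(x)\phi_{k'}(x)]$ and $\widehat C:=(1/n)\Phi^T\Phi$.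
   Context: Setting. Let $\mathcal X\subset\mathbb R^M$. The training data $D=\{(x_1,y_1),\dots,(x_n,y_n)\}$ are i.i.d. from a joint density $p(x,y)=p(x)p(y|x)$ on $\mathcal X\times\mathbb R$, with $y_i=f_*(x_i)+\xi_i$, where $f_*\in L^2(\mathcal X)$ is an unknown regression function and the noise $\xi_i$ has mean zero and variance $\sigma^2$ and is independent of $x_i$. Subscripts on $E$ indicate the random variables over which the expectation is taken. Given real-valued functions $\phi_1,\dots,\phi_d$ on $\mathcal X$, put $f_d(x;\alpha)=\sum_{k=1}^d\alpha_k\phi_k(x)$ for $\alpha\in\mathbb R^d$ and $\mathcal M_d=\{f_d(\cdot;\alpha):\alpha\in\mathbb R^d\}$. The loss of a (fixed) function $f$ is $L(f)=E_{x,y}[(y-f(x))^2]$, where $(x,y)\sim p$ (so in $L(f_d(\cdot;\hat\alpha(D)))$ the point $(x,y)$ is a fresh draw independent of $D$). The empirical loss is $L_D(f)=\frac1n\sum_{i=1}^n(y_i-f(x_i))^2$. $\Phi$ is the $n\times d$ matrix with $(i,k)$ entry $\phi_k(x_i)$. The least squares estimator is $\hat\alpha(D)=\operatorname{argmin}_{\alpha\in\mathbb R^d}L_D(f_d(\cdot;\alpha))=(\Phi^T\Phi)^{-1}\Phi^Ty$ with $y=(y_1,\dots,y_n)^T$. Implicit standing assumptions: $d<n$, $\Phi^T\Phi$ is invertible almost surely, all expectations appearing exist and are finite, and the denominator in the definition of $T^*(n,d)$ is nonzero. *)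

(* Defs.v *)
From HB Require Import structures.
From mathcomp Require Import all_boot all_order all_algebra.
From mathcomp Require Import all_classical all_reals all_analysis.

Set Implicit Arguments.
Unset Strict Implicit.
Unset Printing Implicit Defensive.
Import Order.TTheory GRing.Theory Num.Theory.
Import numFieldNormedType.Exports.

Local Open Scope classical_set_scope.
Local Open Scope ring_scope.

Lemma product_sigma_finite d1 d2 (T1 : measurableType d1)
    (T2 : measurableType d2) (R : realType)
    (m1 : {sigma_finite_measure set T1 -> \bar R})
    (m2 : {sigma_finite_measure set T2 -> \bar R}) :
  sigma_finite setT (m1 \x m2)%E.
Proof.
have /sigma_finiteP[F [TF ndF Foo]] := sigma_finiteT m1.
have /sigma_finiteP[G [TG ndG Goo]] := sigma_finiteT m2.
exists (fun n => F n `*` G n).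
  rewrite -setXTT TF TG predeqE => -[x y]; split.
    move=> [/= [n _ Fnx] [k _ Gky]]; exists (maxn n k) => //; split.
    - by move: x Fnx; exact/subsetPset/ndF/leq_maxl.
    - by move: y Gky; exact/subsetPset/ndG/leq_maxr.
  by move=> [n _ []/= ? ?]; split; exists n.
move=> k; have [? ?] := Foo k; have [? ?] := Goo k.
split; first exact: measurableX.
by rewrite product_measure1E// lte_mul_pinfty// ge0_fin_numE.
Qed.

(* R^n is [n.-tuple R] with the product sigma-algebra provided by the library. *)
Section LebesgueTuple.
Variable R : realType.

Definition cons_pair n (z : measurableTypeR R * n.-tuple R) : n.+1.-tuple R :=
  [tuple of z.1 :: z.2].

Lemma measurable_cons_pair n : measurable_fun setT (@cons_pair n).
Proof.
exact: (@measurable_cons _ _ (measurableTypeR R * n.-tuple R)%type R fst n snd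
  measurable_fst measurable_snd).
Qed.

Section step.
Variables (n : nat) (m : {sigma_finite_measure set (n.-tuple R) -> \bar R}).

Definition lebesgue_tuple_step : set (n.+1.-tuple R) -> \bar R :=
  pushforward (@lebesgue_measure R \x m)%E (@cons_pair n).

Let step0 : lebesgue_tuple_step set0 = 0%E.
Proof. by rewrite /lebesgue_tuple_step /pushforward preimage_set0 measure0. Qed.

Let step_ge0 A : (0 <= lebesgue_tuple_step A)%E.
Proof. by rewrite /lebesgue_tuple_step /pushforward measure_ge0. Qed.

Let step_sigma_additive : semi_sigma_additive lebesgue_tuple_step.
Proof.
have mc := @measurable_cons_pair n.
exact: (@measure_semi_sigma_additive _ _ _
  (measure_function_pushforward__canonical__measure_function_Measure
     (@lebesgue_measure R \x m)%E mc)).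
Qed.

HB.instance Definition _ := isMeasure.Build _ _ _ lebesgue_tuple_step
  step0 step_ge0 step_sigma_additive.

Let step_sigma_finite : sigma_finite setT lebesgue_tuple_step.
Proof.
have [F UF mF] := product_sigma_finite (@lebesgue_measure R) m.
pose split (t : n.+1.-tuple R) : measurableTypeR R * n.-tuple R :=
  (thead t, [tuple of behead t]).
have splitK z : split (cons_pair z) = z.
  by case: z => a t; congr pair; apply/val_inj.
have msplit : measurable_fun setT split.
  apply/measurable_fun_pairP; split.
    exact: (measurable_tnth ord0).
  exact: measurable_behead.
exists (fun k => split @^-1` F k).
  by rewrite -preimage_bigcup -UF preimage_setT.
move=> k; have [mFk Fk] := mF k; split.
  by rewrite -[X in measurable X]setTI; exact: msplit.
rewrite /lebesgue_tuple_step /pushforward -comp_preimage.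
by rewrite (_ : split \o _ = id) //; apply/funext => z; exact: splitK.
Qed.

HB.instance Definition _ := @Measure_isSigmaFinite.Build _ _ _
  lebesgue_tuple_step step_sigma_finite.

End step.

(* Lebesgue measure on R^n, as the n-fold product of the one on R. *)
Fixpoint lebesgue_tuple n : {sigma_finite_measure set (n.-tuple R) -> \bar R} :=
  match n with
  | 0 => @dirac _ (0.-tuple R) [tuple] R
  | n.+1 => lebesgue_tuple_step (lebesgue_tuple n)
  end.
End LebesgueTuple.

Section Independence.
Context {R : realType} d (Omega : measurableType d) (P : probability Omega R).
Local Open Scope ereal_scope.

Definition independent d1 d2 (T1 : measurableType d1) (T2 : measurableType d2)
    (U : Omega -> T1) (V : Omega -> T2) : Prop :=
  forall A B, measurable A -> measurable B ->
    P (U @^-1` A `&` V @^-1` B) = P (U @^-1` A) * P (V @^-1` B).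

Definition mutually_independent d1 (T1 : measurableType d1) n
    (U : 'I_n -> Omega -> T1) : Prop :=
  forall (J : {set 'I_n}) (A : 'I_n -> set T1),
    (forall i, measurable (A i)) ->
    P [set w | forall i, i \in J -> A i (U i w)] =
      \prod_(i in J) P (U i @^-1` A i).

End Independence.

(* Random matrices and vectors carry the sigma-algebra generated by the
   entries, i.e. the Borel sigma-algebra of R^(m * n). *)
Definition entry_cylinders (R : realType) m n : set (set 'M[R]_(m, n)) :=
  [set A | exists i j (B : set R),
     measurable B /\ A = [set N : 'M[R]_(m, n) | B (N i j)]].

Definition measurable_mx (R : realType) m n :=
  g_sigma_algebraType (@entry_cylinders R m n).

Definition argmin d (U : Type) (V : porderType d) (S : set U) (g : U -> V) :
  set U := [set u | S u /\ forall v, S v -> (g u <= g v)%O].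

Section Regression.
Variables (R : realType) (M n d : nat).
Notation T := (M.-tuple R).
Variables (X : set T) (phi : 'I_d -> T -> R).

(* [p] is used on [X * R] only; [mu] is the joint law of [(x, y)]. *)
Definition has_joint_density (mu : probability (T * R)%type R)
    (p : T * R -> R) : Prop :=
  [/\ measurable_fun (X `*` [set: R]) p,
      forall z, X z.1 -> 0 <= p z &
      forall A : set (T * R)%type, measurable A ->
        mu A = (\int[lebesgue_tuple R M \x @lebesgue_measure R]_(z in
                  A `&` (X `*` [set: R])) (p z)%:E)%E].

Definition linear_fun (alpha : 'cV[R]_d) (x : T) : R :=
  \sum_(k < d) alpha k 0 * phi k x.

(* Functions on [X] are represented by functions on R^M, whose values outside
   [X] are irrelevant. *)
Definition linear_model : set (T -> R) :=
  [set f | exists alpha, forall x, X x -> f x = linear_fun alpha x].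

Definition loss (mu : probability (T * R)%type R) (f : T -> R) : \bar R :=
  (\int[mu]_(z in X `*` [set: R]) ((z.2 - f z.1) ^+ 2)%:E)%E.

Definition marginal (mu : probability (T * R)%type R) : set T -> \bar R :=
  pushforward mu fst.

Definition second_moment_mx (mu : probability (T * R)%type R) : 'M[R]_d :=
  \matrix_(k, k') fine (\int[marginal mu]_(x in X) (phi k x * phi k' x)%:E)%E.

Notation data := ('I_n -> T * R).

Definition empirical_loss (D : data) (f : T -> R) : R :=
  n%:R^-1 * \sum_(i < n) ((D i).2 - f (D i).1) ^+ 2.

Definition design_mx (D : data) : 'M[R]_(n, d) :=
  \matrix_(i, k) phi k (D i).1.

Definition gram_mx (D : data) : 'M[R]_d := (design_mx D)^T *m design_mx D.

Definition empirical_second_moment_mx (D : data) : 'M[R]_d :=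
  n%:R^-1 *: gram_mx D.

Definition residual (f : T -> R) (D : data) : 'cV[R]_n :=
  \col_i ((D i).2 - f (D i).1).

(* When the Gram matrix is invertible the minimizer is unique, and equal to
   (Phi^T Phi)^-1 Phi^T y; on other data sets nothing is required. *)
Definition least_squares (alphahat : data -> 'cV[R]_d) : Prop :=
  forall D : data, (forall i, X (D i).1) -> gram_mx D \in unitmx ->
    argmin setT (fun alpha => empirical_loss D (linear_fun alpha))
      (alphahat D).

Section Ratio.
Context dO (Omega : measurableType dO) (P : probability Omega R).
Variables (mu : probability (T * R)%type R) (D : Omega -> data).
Variable alphahat : data -> 'cV[R]_d.

Definition expected_loss : \bar R :=
  (\int[P]_w loss mu (linear_fun (alphahat (D w))))%E.

Definition expected_empirical_loss : \bar R :=
  (\int[P]_w (empirical_loss (D w) (linear_fun (alphahat (D w))))%:E)%E.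

Definition loss_ratio : R := fine expected_loss / fine expected_empirical_loss.

Definition expected_trace : \bar R :=
  (\int[P]_w (\tr (second_moment_mx mu *m
                   invmx (empirical_second_moment_mx (D w))))%:E)%E.
End Ratio.

End Regression.

(* Main.v *)
(* Write f_d(.; beta) for the best approximation, r for the vector of residuals
   y_i - f_d(x_i; beta), and s2 for its loss. Optimality of beta makes the
   residuals orthogonal to every phi_k, so L(f_d(.; a)) = s2 +
   (a - beta)^T C (a - beta), and, as phi_1 = 1, the r_i are centred; being
   i.i.d., they satisfy E[r_i r_j] = s2 if i = j and 0 otherwise. Since
   alphahat - beta = B r with B = (Phi^T Phi)^-1 Phi^T, the loss of the estimator
   is s2 + r^T (B^T C B) r and its empirical loss is (1/n) r^T (1 - Phi B) r.
   Both matrices depend on Phi only, hence are independent of r, and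
   E[r^T A r] = s2 E[Tr A] with Tr (B^T C B) = Tr (C (Phi^T Phi)^-1) and
   Tr (1 - Phi B) = n - d. The entries are integrable because |Q_ij| <= Tr Q for
   Q positive semidefinite. *)

Require Import Defs.
From HB Require Import structures.
From mathcomp Require Import all_boot all_order all_algebra.
From mathcomp Require Import all_classical all_reals all_analysis.
From mathcomp Require Import measurable_realfun lra ring.

Set Implicit Arguments.
Unset Strict Implicit.
Unset Printing Implicit Defensive.
Import Order.TTheory GRing.Theory Num.Theory.
Import numFieldNormedType.Exports.

Local Open Scope classical_set_scope.
Local Open Scope ring_scope.

(** * Integrals of real functions and square integrability *)

Section RealIntegral.
Context d (T : measurableType d) (R : realType).
Variable m : {measure set T -> \bar R}.
Local Notation integrable f := (m.-integrable [set: T] (EFin \o f)).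
Implicit Types f g : T -> R.

Lemma integrable_EFinD f g :
  integrable f -> integrable g -> integrable (fun x => f x + g x).
Proof.
by move=> mf mg; apply: eq_integrable (integrableD _ mf mg).
Qed.

Lemma integrable_EFinZl (k : R) f : integrable f -> integrable (fun x => k * f x).
Proof.
by move=> mf; apply: eq_integrable (integrableZl _ k mf).
Qed.

Lemma integrable_EFin_sum (I : Type) (s : seq I) (F : I -> T -> R) :
  (forall i, integrable (F i)) -> integrable (fun x => \sum_(i <- s) F i x).
Proof.
move=> mF; have := @integrable_sum _ _ _ m setT measurableT I s xpredT
  (fun i => EFin \o F i) (fun i _ => mF i).
by apply: eq_integrable => // x _ /=; rewrite sumEFin.
Qed.

Lemma Rintegral_sum (I : Type) (s : seq I) (F : I -> T -> R) :
  (forall i, integrable (F i)) ->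
  \int[m]_x (\sum_(i <- s) F i x) = \sum_(i <- s) \int[m]_x F i x.
Proof.
move=> mF; elim: s => [|i s IH].
  under eq_Rintegral do rewrite big_nil.
  by rewrite big_nil Rintegral_cst// mul0r.
under eq_Rintegral do rewrite big_cons.
rewrite big_cons RintegralD//; first by rewrite IH.
exact: integrable_EFin_sum.
Qed.

Lemma integrable_EFinE f : integrable f ->
  (\int[m]_x (f x)%:E)%E = (\int[m]_x f x)%:E.
Proof. by move=> mf; rewrite /Rintegral fineK//; exact: integrable_fin_num. Qed.

Lemma le_integrable_EFin f g : measurable_fun [set: T] f ->
  (forall x, `|f x| <= `|g x|) -> integrable g -> integrable f.
Proof.
move=> mf fg; apply: le_integrable => //.
  exact/measurable_EFinP.
by move=> x _ /=; rewrite lee_fin.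
Qed.

Lemma ae_eq_Rintegral f g : measurable_fun [set: T] f ->
  measurable_fun [set: T] g -> ae_eq m [set: T] f g ->
  \int[m]_x f x = \int[m]_x g x.
Proof.
move=> mf mg fg; congr fine; apply: ae_eq_integral => //.
- exact/measurable_EFinP.
- exact/measurable_EFinP.
by apply: filterS fg => x /[apply] ->.
Qed.

(** Measurability is a separate clause because integrability of the square does not imply that [f]
    itself is measurable. *)
Definition square_integrable f :=
  measurable_fun [set: T] f /\ integrable (fun x => f x ^+ 2).

(** The product is dominated by [f ^ 2 + g ^ 2], since [a * b <= a ^ 2 + b ^ 2] for the absolute
    values [a] and [b]. *)
Lemma square_integrableM f g : square_integrable f -> square_integrable g ->
  integrable (fun x => f x * g x).
Proof.
move=> [mf f2] [mg g2].
apply: le_integrable_EFin (integrable_EFinD f2 g2); first exact: measurable_funM.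
move=> x; rewrite normrM [leRHS]ger0_norm ?addr_ge0 ?sqr_ge0//.
rewrite -(real_normK (num_real (f x))) -(real_normK (num_real (g x))).
have := normr_ge0 (f x); have := normr_ge0 (g x).
by move: `|f x| `|g x| => a b; nra.
Qed.

Lemma square_integrableD f g : square_integrable f -> square_integrable g ->
  square_integrable (fun x => f x + g x).
Proof.
move=> Lf Lg; have fg := square_integrableM Lf Lg.
case: Lf Lg => [mf f2] [mg g2]; split; first exact: measurable_funD.
have := integrable_EFinD (integrable_EFinD f2 g2) (integrable_EFinZl 2 fg).
by apply: eq_integrable => // x _ /=; congr EFin; ring.
Qed.

Lemma square_integrableZl (k : R) f : square_integrable f ->
  square_integrable (fun x => k * f x).
Proof.
move=> [mf f2]; split; first exact: measurable_funM.
have := integrable_EFinZl (k ^+ 2) f2.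
by apply: eq_integrable => // x _ /=; congr EFin; ring.
Qed.

Lemma square_integrableB f g : square_integrable f -> square_integrable g ->
  square_integrable (fun x => f x - g x).
Proof.
move=> Lf /(square_integrableZl (- 1)) /(square_integrableD Lf).
by under eq_fun do rewrite mulN1r.
Qed.

Lemma square_integrable_sum (I : Type) (s : seq I) (F : I -> T -> R) :
  (forall i, square_integrable (F i)) ->
  square_integrable (fun x => \sum_(i <- s) F i x).
Proof.
move=> LF; elim: s => [|i s IH].
  under eq_fun do rewrite big_nil; split; first exact: measurable_cst.
  by under eq_fun do rewrite expr0n; exact: integrable0.
by under eq_fun do rewrite big_cons; exact: square_integrableD.
Qed.

Lemma square_integrable_lin d' (F : 'I_d' -> T -> R) (a : 'I_d' -> R) :
  (forall k, square_integrable (F k)) ->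
  square_integrable (fun x => \sum_k a k * F k x).
Proof.
by move=> LF; apply: square_integrable_sum => k; exact: square_integrableZl.
Qed.

(* First variation of [t |-> E (f - t g)^2] at [t = 0]. *)
Lemma orthogonal_of_minimal f g : square_integrable f -> square_integrable g ->
  (forall t : R, \int[m]_x (f x ^+ 2) <= \int[m]_x ((f x - t * g x) ^+ 2)) ->
  \int[m]_x (f x * g x) = 0.
Proof.
move=> Lf Lg min; have fg := square_integrableM Lf Lg.
case: Lf Lg => [mf f2] [mg g2].
set b := \int[m]_x (f x * g x); pose c := \int[m]_x (g x ^+ 2).
have c0 : 0 <= c by apply: Rintegral_ge0 => x _; exact: sqr_ge0.
have quad t : 0 <= - (2 * t * b) + t ^+ 2 * c.
  have /= := min t; rewrite [leRHS](_ : _ =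
    \int[m]_x (f x ^+ 2 + ((- (2 * t)) * (f x * g x) + t ^+ 2 * g x ^+ 2))); last first.
    by apply: eq_Rintegral => x _; ring.
  have i1 := integrable_EFinZl (- (2 * t)) fg.
  have i2 := integrable_EFinZl (t ^+ 2) g2.
  rewrite RintegralD//; last exact: integrable_EFinD.
  by rewrite RintegralD// !RintegralZl// -/b -/c; lra.
(* The quadratic is least at [b / c], but [c] may be [0]. At [b / (c + 1)] it equals
   [- (b / (c + 1)) ^ 2 * (c + 2)], which is negative unless [b = 0]. *)
have /= := quad (b / (c + 1)).
have c1 : 0 < c + 1 by lra.
have -> : - (2 * (b / (c + 1)) * b) + (b / (c + 1)) ^+ 2 * c =
    - (b / (c + 1)) ^+ 2 * (c + 2).
  by field; rewrite gt_eqF.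
move=> h; have : (b / (c + 1)) ^+ 2 <= 0 by have := sqr_ge0 (b / (c + 1)); nra.
rewrite le_eqVlt ltNge sqr_ge0 orbF sqrf_eq0 mulf_eq0 invr_eq0 => /orP[/eqP//|].
by rewrite gt_eqF.
Qed.

End RealIntegral.

(** * Change of variables along a map of known law *)

Section Transfer.
Context d1 d2 (T1 : measurableType d1) (T2 : measurableType d2) (R : realType).
Variables (m1 : {measure set T1 -> \bar R}) (m2 : {measure set T2 -> \bar R}).
Variables (Y : T1 -> T2) (S : set T2) (f : T2 -> R).
Hypotheses (mY : measurable_fun [set: T1] Y) (YS : forall x, S (Y x)).
Hypothesis lawY : forall A, measurable A -> m1 (Y @^-1` A) = m2 A.
Hypotheses (mS : measurable S) (mf : measurable_fun S f).

Lemma measurable_transfer : measurable_fun [set: T1] (f \o Y).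
Proof. by apply: (measurable_comp mS) => // _ [x _ <-]. Qed.

(** All values of [Y] lie in [S], so the preimage of [S] is the whole space. A function that is
    measurable on [S] only, such as a feature on the input domain, thus pulls back to an integral
    over all of [T1]. *)
Lemma ge0_integral_transfer (g : T2 -> \bar R) : measurable_fun S g ->
  (forall y, 0 <= g y)%E ->
  (\int[m2]_(y in S) g y = \int[m1]_x g (Y x))%E.
Proof.
move=> mg g0.
have -> : (\int[m2]_(y in S) g y = \int[pushforward m1 Y]_(y in S) g y)%E.
  pose mY' := isMeasurableFun.Build _ _ _ _ _ mY.
  pose Y' : {mfun T1 >-> T2} := HB.pack Y mY'.
  apply: (eq_measure_integral (pushforward m1 Y')) => A mA _.
  by rewrite -lawY.
rewrite ge0_integral_pushforward//.
have -> : Y @^-1` S = setT by apply/seteqP; split => // x _; exact: YS.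
by [].
Qed.

Lemma integrable_transfer : m2.-integrable S (EFin \o f) ->
  m1.-integrable setT (EFin \o (f \o Y)).
Proof.
move=> /integrableP[mf' fi]; apply/integrableP; split.
  by apply/measurable_EFinP; exact: measurable_transfer.
by rewrite -(@ge0_integral_transfer (fun y => `|(f y)%:E|))%E//;
  exact: measurableT_comp.
Qed.

(** The positive and negative parts are transferred separately, each by the nonnegative case. *)
Lemma integral_transfer :
  (\int[m2]_(y in S) (f y)%:E = \int[m1]_x (f (Y x))%:E)%E.
Proof.
have mf' : measurable_fun S (EFin \o f) by exact/measurable_EFinP.
rewrite integralE [RHS]integralE.
rewrite (ge0_integral_transfer (measurable_funepos mf')) => [|y];
  last exact: funepos_ge0.
rewrite (ge0_integral_transfer (measurable_funeneg mf')) => [|y];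
  last exact: funeneg_ge0.
by congr (_ - _)%E; apply: eq_integral => x _; rewrite ?funeposE ?funenegE.
Qed.

End Transfer.

(** * Expectations of constants and of products of independent variables *)

Lemma Rintegral_cst_probability (R : realType) d (T : measurableType d)
  (P : probability T R) (k : R) : \int[P]_w k = k.
Proof.
rewrite Rintegral_cst// -[RHS]mulr1; congr (_ * _).
exact: (congr1 fine (probability_setT P)).
Qed.

Section IndependentProduct.
Context {R : realType} d (T : measurableType d) (P : probability T R).

Lemma independent_comp d1 d2 d3 d4 (T1 : measurableType d1)
    (T2 : measurableType d2) (T3 : measurableType d3) (T4 : measurableType d4)
    (U : T -> T1) (V : T -> T2) (f : T1 -> T3) (g : T2 -> T4) :
  measurable_fun setT f -> measurable_fun setT g ->
  independent P U V -> independent P (f \o U) (g \o V).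
Proof.
move=> mf mg UV A B mA mB.
have := UV (f @^-1` A) (g @^-1` B).
by apply; rewrite -[X in measurable X]setTI; [exact: mf|exact: mg].
Qed.

Variables f g : T -> R.
Hypotheses (fi : P.-integrable setT (EFin \o f)).
Hypotheses (gi : P.-integrable setT (EFin \o g)).
Hypothesis fg : independent P f g.

Let mf : measurable_fun setT f.
Proof. by case/integrableP: fi => /measurable_EFinP. Qed.
Let mg : measurable_fun setT g.
Proof. by case/integrableP: gi => /measurable_EFinP. Qed.

Let f' : {mfun T >-> R} := HB.pack f (isMeasurableFun.Build _ _ _ _ _ mf).
Let g' : {mfun T >-> R} := HB.pack g (isMeasurableFun.Build _ _ _ _ _ mg).

(* Independence identifies the joint law with the product law, and Fubini
   applies to the latter. *)
Let lawE (A : set (R * R)) : measurable A ->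
  (distribution P f' \x distribution P g')%E A = P ((fun w => (f w, g w)) @^-1` A).
Proof.
have mfg : measurable_fun setT (fun w => (f' w, g' w)).
  exact: measurable_fun_pair.
pose h : {mfun T >-> (R * R)%type} :=
  HB.pack (fun w => (f' w, g' w)) (isMeasurableFun.Build _ _ _ _ _ mfg).
apply: (@product_measure_unique _ _ _ _ _ _ _ (distribution P h)) => B C mB mC.
exact: fg.
Qed.

Let mM : measurable_fun setT (fun z : R * R => z.1 * z.2).
Proof. by apply: measurable_funM; [exact: measurable_fst|exact: measurable_snd]. Qed.

Let mpair : measurable_fun setT (fun w => (f w, g w) : (R * R)%type).
Proof. exact: measurable_fun_pair. Qed.

Let integrable_id (h : {mfun T >-> R}) :
  P.-integrable setT (EFin \o h) ->
  (distribution P h).-integrable setT (EFin \o id).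
Proof.
move=> hi; apply: integrable_pushforward => //.
by apply/measurable_EFinP; exact: measurable_id.
Qed.

Let integral_id (h : {mfun T >-> R}) :
  P.-integrable setT (EFin \o h) ->
  (\int[distribution P h]_x x%:E = (\int[P]_w h w)%:E)%E.
Proof.
by move=> hi; rewrite (integral_distribution (f := EFin))// integrable_EFinE.
Qed.

(** By Tonelli the integral of [|x * y|] against the product law is [E|f| * E|g|], a product of
    finite factors. *)
Let integrable_prod : (distribution P f' \x distribution P g')%E.-integrable setT
  (fun z => (z.1 * z.2)%:E).
Proof.
apply/integrable12ltyP; first exact/measurable_EFinP.
have /integrableP[_ f1] := integrable_id (h := f') fi.
have /integrableP[_ g1] := integrable_id (h := g') gi.
under eq_integral => x _.
  under eq_integral do rewrite /= normrM EFinM.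
  rewrite ge0_integralZl//; last exact: measurableT_comp.
  over.
rewrite ge0_integralZr//; [|exact: measurableT_comp|exact: integral_ge0].
rewrite lte_mul_pinfty//; first exact: integral_ge0.
by rewrite ge0_fin_numE//; exact: integral_ge0.
Qed.

Lemma independent_integrableM : P.-integrable setT (EFin \o (fun w => f w * g w)).
Proof.
apply: (integrable_transfer (m2 := (distribution P f' \x distribution P g')%E)
  (S := setT) (f := fun z => z.1 * z.2) mpair) => // A mA.
by apply/esym/lawE.
Qed.

Lemma independent_RintegralM :
  \int[P]_w (f w * g w) = (\int[P]_w f w) * (\int[P]_w g w).
Proof.
apply: EFin_inj; rewrite -integrable_EFinE; last exact: independent_integrableM.
rewrite -(integral_transfer (m2 := (distribution P f' \x distribution P g')%E)
  (S := setT) (f := fun z => z.1 * z.2) mpair)// => [|A mA]; last exact/esym/lawE.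
rewrite -integral12_prod_meas1//= /fubini_F.
under eq_integral => x _.
  under eq_integral do rewrite /= EFinM.
  rewrite integralZl//; last exact: integrable_id.
  rewrite integral_id//; over.
rewrite integralZr//; last exact: integrable_id.
by rewrite integral_id.
Qed.

End IndependentProduct.

(** * Positive semidefinite quadratic forms *)

Section PositiveSemidefinite.
Variable R : realFieldType.

Lemma mxform_norm n (w : 'cV[R]_n) : (w^T *m w) 0 0 = \sum_i w i 0 ^+ 2.
Proof. by rewrite mxE; apply: eq_bigr => i _; rewrite mxE expr2. Qed.

Lemma mxform_norm_ge0 n (w : 'cV[R]_n) : 0 <= (w^T *m w) 0 0.
Proof. by rewrite mxform_norm sumr_ge0// => i _; exact: sqr_ge0. Qed.

Lemma mxform_norm_eq0 n (w : 'cV[R]_n) : (w^T *m w) 0 0 <= 0 -> w = 0.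
Proof.
rewrite mxform_norm => w0; apply/colP => i; rewrite mxE; apply/eqP.
rewrite -sqrf_eq0; apply/eqP.
have /psumr_eq0P : \sum_i w i 0 ^+ 2 = 0.
  by apply: le_anti; rewrite w0 sumr_ge0// => j _; exact: sqr_ge0.
by apply => // j _; exact: sqr_ge0.
Qed.

Lemma mxform_normB_orth n (e w : 'cV[R]_n) : w^T *m e = 0 ->
  ((e - w)^T *m (e - w)) 0 0 = (e^T *m e) 0 0 + (w^T *m w) 0 0.
Proof.
move=> we; have ew : e^T *m w = 0 by rewrite -[LHS]trmxK trmx_mul trmxK we trmx0.
rewrite [trmx (_ - _)]linearB/= mulmxBl !mulmxBr we ew subr0 sub0r opprK.
by rewrite mxE.
Qed.

Lemma mxformE n (v : 'cV[R]_n) (Q : 'M[R]_n) :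
  (v^T *m Q *m v) 0 0 = \sum_i \sum_j v i 0 * v j 0 * Q i j.
Proof.
rewrite mxE exchange_big/=; apply: eq_bigr => j _.
rewrite mxE big_distrl/=; apply: eq_bigr => i _.
by rewrite mxE mulrAC.
Qed.

(* Positivity of the form at [e_i + e_j] and [e_i - e_j]. *)
Lemma psd_entry_le_trace n (Q : 'M[R]_n) : Q^T = Q ->
  (forall v : 'cV[R]_n, 0 <= (v^T *m Q *m v) 0 0) ->
  forall i j, `|Q i j| <= \tr Q.
Proof.
move=> Qsym psd i j.
have dQd k l : (delta_mx k 0 : 'cV[R]_n)^T *m Q *m (delta_mx l 0 : 'cV[R]_n) =
    (Q k l)%:M.
  rewrite trmx_delta -rowE -colE; apply/matrixP => a b.
  by rewrite !ord1 !mxE eqxx mulr1n.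
have diag k : 0 <= Q k k by have := psd (delta_mx k 0); rewrite dQd mxE eqxx mulr1n.
have Qji : Q j i = Q i j by rewrite -[in LHS]Qsym mxE.
have h (s : R) : s ^+ 2 = 1 -> 0 <= Q i i + Q j j + s * Q i j *+ 2.
  move=> s2; have := psd (delta_mx i 0 + s *: delta_mx j 0).
  rewrite [trmx (_ + _)]linearD/= [trmx (_ *: _)]linearZ/= !mulmxDl !mulmxDr.
  rewrite -!scalemxAl -!scalemxAr.
  rewrite !dQd scalerA -expr2 s2 scale1r !mxE eqxx !mulr1n Qji.
  by congr (_ <= _); ring.
(* The cases [s = 1] and [s = -1] of [h] bound [|Q i j|] by this average. Taking the average rather
   than the sum keeps the bound by the trace valid when [i = j]. *)
have trQ : (Q i i + Q j j) / 2 <= \tr Q.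
  rewrite /mxtrace; have [->|ij] := eqVneq i j.
    by rewrite (bigD1 j)//= -[leLHS]addr0 lerD ?sumr_ge0//; lra.
  rewrite (bigD1 i)//= (bigD1 j) 1?eq_sym//= addrA -[leLHS]addr0 lerD ?sumr_ge0//.
  by have := diag i; have := diag j; lra.
rewrite ler_norml; have := h 1 (expr1n _ _).
have := h (-1); rewrite sqrrN expr1n => /(_ erefl).
by move=> hm hp; apply/andP; split; lra.
Qed.

End PositiveSemidefinite.

(** * Algebra of the least squares projection *)

Section OrdinaryLeastSquares.
Variables (R : realFieldType) (n d : nat).
Implicit Type Phi : 'M[R]_(n, d).

(* Equal to [(Phi^T Phi)^-1 Phi^T], written so that its entries are
   measurable in [Phi]; since [0^-1 = 0] it is [0] when [Phi^T Phi] is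
   singular. *)
Definition ols_mx Phi : 'M[R]_(d, n) :=
  (\det (Phi^T *m Phi))^-1 *: (\adj (Phi^T *m Phi) *m Phi^T).

(** The orthogonal projection onto the column space of [Phi] when the Gram matrix is invertible, and
    [0] otherwise; it is symmetric and idempotent in both cases. *)
Definition hat_mx Phi : 'M[R]_n := Phi *m ols_mx Phi.

Lemma ols_mx_unit Phi : Phi^T *m Phi \in unitmx ->
  ols_mx Phi = invmx (Phi^T *m Phi) *m Phi^T.
Proof. by move=> u; rewrite /ols_mx /invmx u scalemxAl. Qed.

Lemma ols_mx_singular Phi : Phi^T *m Phi \notin unitmx -> ols_mx Phi = 0.
Proof.
by rewrite unitmxE unitfE negbK /ols_mx => /eqP ->; rewrite invr0 scale0r.
Qed.

Lemma trmx_gram Phi : (Phi^T *m Phi)^T = Phi^T *m Phi.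
Proof. by rewrite trmx_mul trmxK. Qed.

Lemma hat_mx_sym Phi : (hat_mx Phi)^T = hat_mx Phi.
Proof.
rewrite /hat_mx; have [u|/ols_mx_singular ->] := boolP (Phi^T *m Phi \in unitmx).
  by rewrite ols_mx_unit// !trmx_mul trmxK trmx_inv trmx_gram mulmxA.
by rewrite mulmx0 trmx0.
Qed.

Lemma hat_mx_idem Phi : hat_mx Phi *m hat_mx Phi = hat_mx Phi.
Proof.
rewrite /hat_mx; have [u|/ols_mx_singular ->] := boolP (Phi^T *m Phi \in unitmx).
  rewrite ols_mx_unit// -!mulmxA; congr (_ *m _).
  by rewrite [Phi^T *m (Phi *m _)]mulmxA mulKmx.
by rewrite !mulmx0.
Qed.

Lemma hat_mx_trace Phi : Phi^T *m Phi \in unitmx -> \tr (hat_mx Phi) = d%:R.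
Proof.
by move=> u; rewrite /hat_mx mxtrace_mulC ols_mx_unit// -mulmxA mulVmx// mxtrace1.
Qed.

Lemma hat_mx_trace_le Phi : \tr (hat_mx Phi) <= d%:R.
Proof.
have [/hat_mx_trace ->//|/ols_mx_singular] := boolP (Phi^T *m Phi \in unitmx).
by rewrite /hat_mx => ->; rewrite mulmx0 mxtrace0.
Qed.

(** A symmetric idempotent [H] is positive semidefinite, as [v^T H v = |H v|^2], so its entries are
    bounded by its trace. The bound is uniform in [Phi], which makes the entries integrable for a
    random [Phi]. *)
Lemma hat_mx_entry_le Phi i j : `|hat_mx Phi i j| <= d%:R.
Proof.
apply: le_trans (hat_mx_trace_le Phi); apply: psd_entry_le_trace => [|v].
  exact: hat_mx_sym.
have -> : v^T *m hat_mx Phi *m v = (hat_mx Phi *m v)^T *m (hat_mx Phi *m v).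
  by rewrite trmx_mul hat_mx_sym mulmxA -[v^T *m _ *m hat_mx _]mulmxA hat_mx_idem.
exact: mxform_norm_ge0.
Qed.

Lemma ols_mx_gram Phi : Phi^T *m Phi \in unitmx ->
  ols_mx Phi *m (ols_mx Phi)^T = invmx (Phi^T *m Phi).
Proof.
move=> u; rewrite ols_mx_unit// trmx_mul trmxK trmx_inv trmx_gram -mulmxA.
by rewrite [X in _ *m X = _]mulmxA mulmxV// mulmx1.
Qed.

Lemma ols_mxK Phi (v : 'cV[R]_d) : Phi^T *m Phi \in unitmx ->
  ols_mx Phi *m (Phi *m v) = v.
Proof. by move=> u; rewrite ols_mx_unit// -mulmxA [X in _ *m X]mulmxA mulKmx. Qed.

(* Pythagoras: [Phi (v - ols y)] is orthogonal to [y - Phi (ols y)]. *)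
Lemma minimizer_ols Phi (y : 'cV[R]_n) (a : 'cV[R]_d) :
  Phi^T *m Phi \in unitmx ->
  (forall v : 'cV[R]_d, ((y - Phi *m a)^T *m (y - Phi *m a)) 0 0 <=
     ((y - Phi *m v)^T *m (y - Phi *m v)) 0 0) ->
  a = ols_mx Phi *m y.
Proof.
move=> u /(_ (ols_mx Phi *m y)); set a0 := ols_mx Phi *m y.
pose e := y - Phi *m a0; pose w := Phi *m (a - a0).
have -> : y - Phi *m a = e - w by rewrite /e /w mulmxBr opprB addrA subrK.
have Phie : Phi^T *m e = 0.
  by rewrite /e mulmxBr /a0 ols_mx_unit// !mulmxA mulmxV// mul1mx subrr.
have we : w^T *m e = 0 by rewrite /w trmx_mul -mulmxA Phie mulmx0.
rewrite -/e mxform_normB_orth// gerDl => /mxform_norm_eq0 w0.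
(* [Phi] has the left inverse [ols_mx Phi], so [Phi *m (a - a0) = 0] gives [a = a0]. *)
apply/eqP; rewrite -subr_eq0.
by rewrite -[a - a0](ols_mxK _ u) -/w w0 mulmx0.
Qed.

Section Error.
Variables (Phi : 'M[R]_(n, d)) (C : 'M[R]_d) (r : 'cV[R]_n).
Hypothesis Csym : C^T = C.
Hypothesis Cpsd : forall v : 'cV[R]_d, 0 <= (v^T *m C *m v) 0 0.

(** The estimator misses the best coefficients by [ols_mx Phi *m r]; the form of this matrix at [r]
    is the size of that error measured by [C], that is, the excess loss. *)
Definition error_mx : 'M[R]_n := (ols_mx Phi)^T *m C *m ols_mx Phi.

Lemma error_mx_entry_le i j : `|error_mx i j| <= \tr error_mx.
Proof.
apply: psd_entry_le_trace => [|v].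
  by rewrite /error_mx !trmx_mul trmxK Csym mulmxA.
by rewrite /error_mx !mulmxA -trmx_mul -mulmxA.
Qed.

(** Cyclicity of the trace brings the two factors [ols_mx Phi] and its transpose together, and their
    product is the inverse Gram matrix. *)
Lemma error_mx_trace : Phi^T *m Phi \in unitmx ->
  \tr error_mx = \tr (C *m invmx (Phi^T *m Phi)).
Proof.
by move=> u; rewrite /error_mx -mulmxA mxtrace_mulC -mulmxA ols_mx_gram.
Qed.

Lemma error_mx_form :
  (r^T *m error_mx *m r) 0 0 =
  ((ols_mx Phi *m r)^T *m C *m (ols_mx Phi *m r)) 0 0.
Proof. by rewrite /error_mx trmx_mul !mulmxA. Qed.

(** The complementary projection [1 - hat_mx Phi] is again symmetric and idempotent, so the squared
    norm of its image is its own quadratic form. *)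
Lemma ols_residual_norm : ((r - hat_mx Phi *m r)^T *m (r - hat_mx Phi *m r)) 0 0 =
  (r^T *m (1%:M - hat_mx Phi) *m r) 0 0.
Proof.
have -> : r - hat_mx Phi *m r = (1%:M - hat_mx Phi) *m r.
  by rewrite mulmxBl mul1mx.
have idem : (1%:M - hat_mx Phi)^T *m (1%:M - hat_mx Phi) = 1%:M - hat_mx Phi.
  rewrite [trmx (_ - _)]linearB/= trmx1 hat_mx_sym mulmxBl mul1mx mulmxBr mulmx1.
  by rewrite hat_mx_idem subrr subr0.
by rewrite trmx_mul -!mulmxA [_^T *m (_ *m r)]mulmxA idem.
Qed.

End Error.
End OrdinaryLeastSquares.

(** * Measurability of matrix operations *)

Section MatrixMeasurability.
Context (R : realType) dT (T : measurableType dT).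

Definition measurable_entries m n (F : T -> 'M[R]_(m, n)) :=
  forall i j, measurable_fun setT (fun w => F w i j).

(** Writing [1 / f] as [f] times the power [-1] of [f ^ 2] reduces to a power of a nonnegative base;
    where [f] vanishes both sides are [0]. *)
Lemma measurable_inv (f : T -> R) : measurable_fun setT f ->
  measurable_fun setT (fun w => (f w)^-1).
Proof.
move=> mf; rewrite (_ : (fun w => _) = (fun w => f w * (f w ^+ 2) `^ (- 1))).
  apply: measurable_funM => //.
  apply: (measurableT_comp (measurable_powR _)).
  exact: measurable_funX.
apply/funext => w; rewrite powR_inv1 ?sqr_ge0//.
have [->|f0] := eqVneq (f w) 0; first by rewrite invr0 mul0r.
by rewrite expr2 invfM mulrA mulfV// mul1r.
Qed.

Lemma measurable_mulmx m n p (F : T -> 'M[R]_(m, n)) (G : T -> 'M[R]_(n, p)) :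
  measurable_entries F -> measurable_entries G ->
  measurable_entries (fun w => F w *m G w).
Proof.
move=> mF mG i j; under eq_fun do rewrite mxE.
by apply: measurable_sum => k; exact: measurable_funM.
Qed.

Lemma measurable_trmx m n (F : T -> 'M[R]_(m, n)) :
  measurable_entries F -> measurable_entries (fun w => (F w)^T).
Proof. by move=> mF i j; under eq_fun do rewrite mxE; exact: mF. Qed.

Lemma measurable_mxtrace n (F : T -> 'M[R]_n) :
  measurable_entries F -> measurable_fun setT (fun w => \tr (F w)).
Proof. by move=> mF; apply: measurable_sum => i; exact: mF. Qed.

Lemma measurable_det n (F : T -> 'M[R]_n) :
  measurable_entries F -> measurable_fun setT (fun w => \det (F w)).
Proof.
move=> mF; apply: measurable_sum => s; apply: measurable_funM => //.
by apply: measurable_prod => i _; exact: mF.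
Qed.

Lemma measurable_adjugate n (F : T -> 'M[R]_n) :
  measurable_entries F -> measurable_entries (fun w => \adj (F w)).
Proof.
move=> mF i j; under eq_fun do rewrite mxE /cofactor.
apply: measurable_funM => //; apply: measurable_det => k l.
by under eq_fun do rewrite !mxE; exact: mF.
Qed.

Lemma measurable_ols_mx n d (F : T -> 'M[R]_(n, d)) :
  measurable_entries F -> measurable_entries (fun w => ols_mx (F w)).
Proof.
move=> mF i j; under eq_fun do rewrite mxE.
have mG := measurable_mulmx (measurable_trmx mF) mF.
apply: measurable_funM; first exact/measurable_inv/measurable_det.
by apply: measurable_mulmx; [exact: measurable_adjugate|exact: measurable_trmx].
Qed.

Lemma measurable_hat_mx n d (F : T -> 'M[R]_(n, d)) :
  measurable_entries F -> measurable_entries (fun w => hat_mx (F w)).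
Proof. by move=> mF; apply: measurable_mulmx => //; exact: measurable_ols_mx. Qed.

Lemma measurable_error_mx n d (F : T -> 'M[R]_(n, d)) (C : 'M[R]_d) :
  measurable_entries F -> measurable_entries (fun w => error_mx (F w) C).
Proof.
move=> mF; have mB := measurable_ols_mx mF.
by do 2?[apply: measurable_mulmx => //]; exact: measurable_trmx.
Qed.

End MatrixMeasurability.

(** The preimages of measurable sets under the entries are the generators of the sigma-algebra. *)
Lemma measurable_entries_id (R : realType) m n :
  measurable_entries (fun N : measurable_mx R m n => N).
Proof.
move=> i j _ B mB; rewrite setTI.
by apply: sub_sigma_algebra; exists i, j, B.
Qed.

(** * Expectation of a quadratic form whose matrix is independent of its vector *)

Section QuadraticForm.
Context {R : realType} dT (T : measurableType dT) (P : probability T R).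
Context m n d (r : T -> 'M[R]_(m, 1)) (Phi : T -> 'M[R]_(n, d)).
Hypothesis r_Phi : independent P (r : T -> measurable_mx R m 1)
  (Phi : T -> measurable_mx R n d).
Variables (s2 : R) (A : 'M[R]_(n, d) -> 'M[R]_m).
Hypothesis mA : measurable_entries (A : measurable_mx R n d -> 'M[R]_m).
Hypothesis Ai : forall i j, P.-integrable setT (EFin \o (fun w => A (Phi w) i j)).
Hypothesis ri : forall i, square_integrable P (fun w => r w i 0).
Hypothesis rcov : forall i j, \int[P]_w (r w i 0 * r w j 0) = s2 *+ (i == j).

Let rr i j : P.-integrable setT (EFin \o (fun w => r w i 0 * r w j 0)).
Proof. exact: square_integrableM. Qed.

Let rrA i j : independent P (fun w => r w i 0 * r w j 0) (fun w => A (Phi w) i j).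
Proof.
apply: (@independent_comp _ _ _ P _ _ _ _ (measurable_mx R m 1)
  (measurable_mx R n d) R R r Phi (fun N => N i 0 * N j 0) (fun N => A N i j)) => //.
by apply: measurable_funM; exact: measurable_entries_id.
Qed.

Let termi i j : P.-integrable setT
  (EFin \o (fun w => r w i 0 * r w j 0 * A (Phi w) i j)).
Proof. exact: independent_integrableM. Qed.

Lemma integrable_mxform :
  P.-integrable setT (EFin \o (fun w => ((r w)^T *m A (Phi w) *m r w) 0 0)).
Proof.
under [X in EFin \o X]eq_fun do rewrite mxformE.
by apply: integrable_EFin_sum => i; exact: integrable_EFin_sum.
Qed.

(** Each term factors as [E[r_i r_j] * E[A_ij]], and only the diagonal ones survive. *)
Lemma Rintegral_mxform :
  \int[P]_w ((r w)^T *m A (Phi w) *m r w) 0 0 = s2 * \int[P]_w \tr (A (Phi w)).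
Proof.
under eq_Rintegral do rewrite mxformE.
rewrite Rintegral_sum => [|i]; last exact: integrable_EFin_sum.
rewrite Rintegral_sum// mulr_sumr; apply: eq_bigr => i _.
rewrite Rintegral_sum// (bigD1 i)//= big1 => [|j ji].
  by rewrite independent_RintegralM// rcov addr0 eqxx.
rewrite independent_RintegralM// rcov.
by rewrite eq_sym (negPf ji) mul0r.
Qed.

End QuadraticForm.

(** * Moments of the features and of the residuals *)

Section Moments.
Variables (R : realType) (M n d : nat).
Variables (X : set (M.-tuple R)) (phi : 'I_d -> M.-tuple R -> R).
Hypotheses (mX : measurable X) (mphi : forall k, measurable_fun X (phi k)).
Variable mu : probability (M.-tuple R * R)%type R.
Context (dO : measure_display) (Omega : measurableType dO) (P : probability Omega R).
Variable D : Omega -> 'I_n -> M.-tuple R * R.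
Hypotheses (mD : forall i, measurable_fun [set: Omega] (fun w => D w i))
  (DX : forall w i, X (D w i).1)
  (D_law : forall i (A : set (M.-tuple R * R)%type), measurable A ->
     P [set w | A (D w i)] = mu A).
Hypothesis C_fin : forall k k',
  (marginal mu).-integrable X (fun x => (phi k x * phi k' x)%:E).
Hypothesis y_L2 : forall i, square_integrable P (fun w => (D w i).2).
Local Notation C := (second_moment_mx X phi mu).
Local Notation lin := (linear_fun phi).
Implicit Types (i : 'I_n) (k : 'I_d) (a v : 'cV[R]_d).

Lemma measurable_input i : measurable_fun setT (fun w => (D w i).1).
Proof. exact: (measurableT_comp measurable_fst (mD i)). Qed.

Lemma measurable_feature i k : measurable_fun setT (fun w => phi k (D w i).1).
Proof.
exact: (measurable_transfer (f := phi k) (measurable_input i) (DX^~ i) mX).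
Qed.

Lemma marginal_law i (A : set (M.-tuple R)) : measurable A ->
  P ((fun w => (D w i).1) @^-1` A) = marginal mu A.
Proof.
move=> mA; rewrite /marginal /pushforward -(D_law i)//.
by rewrite -[X in measurable X]setTI; exact: measurable_fst.
Qed.

Lemma marginal_integrable i (f : M.-tuple R -> R) : measurable_fun X f ->
  (marginal mu).-integrable X (EFin \o f) ->
  P.-integrable setT (EFin \o (fun w => f (D w i).1)).
Proof.
move=> mf.
exact: (integrable_transfer (m2 := marginal mu) (measurable_input i) (DX^~ i)
  (@marginal_law i) mX mf).
Qed.

Lemma marginal_integral i (f : M.-tuple R -> R) : measurable_fun X f ->
  (\int[marginal mu]_(x in X) (f x)%:E = \int[P]_w (f (D w i).1)%:E)%E.
Proof.
move=> mf.
exact: (integral_transfer (m2 := marginal mu) (measurable_input i) (DX^~ i)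
  (@marginal_law i) mX mf).
Qed.

Lemma square_integrable_feature i k : square_integrable P (fun w => phi k (D w i).1).
Proof.
split; first exact: measurable_feature.
apply: (@marginal_integrable _ (fun x => phi k x ^+ 2)).
  exact: measurable_funX.
exact: C_fin.
Qed.

Lemma square_integrable_linear_fun i a :
  square_integrable P (fun w => lin a (D w i).1).
Proof. by apply: square_integrable_lin => k; exact: square_integrable_feature. Qed.

Lemma second_moment_mxE i k k' :
  C k k' = \int[P]_w (phi k (D w i).1 * phi k' (D w i).1).
Proof.
rewrite mxE (@marginal_integral i (fun x => phi k x * phi k' x))//.
exact: measurable_funM.
Qed.

(** The form of [C] at [v] is the second moment of the linear function with coefficients [v], which
    also shows that [C] is positive semidefinite. *)
Lemma second_moment_mx_form i v :
  (v^T *m C *m v) 0 0 = \int[P]_w (lin v (D w i).1 ^+ 2).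
Proof.
rewrite mxformE; have FF k k' := square_integrableM
  (square_integrable_feature i k) (square_integrable_feature i k').
transitivity (\int[P]_w (\sum_k \sum_k' v k 0 * v k' 0 *
    (phi k (D w i).1 * phi k' (D w i).1))).
  have iF k k' := integrable_EFinZl (v k 0 * v k' 0) (FF k k').
  rewrite Rintegral_sum => [|k]; last exact: integrable_EFin_sum.
  apply: eq_bigr => k _; rewrite Rintegral_sum//.
  by apply: eq_bigr => k' _; rewrite RintegralZl// (second_moment_mxE i).
apply: eq_Rintegral => w _; rewrite expr2 /linear_fun big_distrlr/=.
by apply: eq_bigr => k _; apply: eq_bigr => k' _; rewrite mulrACA.
Qed.

Lemma second_moment_mx_sym : C^T = C.
Proof. by apply/matrixP => k k'; rewrite !mxE; under eq_integral do rewrite mulrC. Qed.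

Lemma second_moment_mx_psd i v : 0 <= (v^T *m C *m v) 0 0.
Proof.
by rewrite (second_moment_mx_form i); apply: Rintegral_ge0 => w _; exact: sqr_ge0.
Qed.

Lemma square_integrable_residual i a :
  square_integrable P (fun w => (D w i).2 - lin a (D w i).1).
Proof. exact: (square_integrableB (y_L2 i) (square_integrable_linear_fun i a)). Qed.

Lemma measurable_linear_fun a : measurable_fun X (lin a).
Proof. by apply: measurable_sum => k; exact: measurable_funM. Qed.

Lemma measurable_residual_fun a :
  measurable_fun (X `*` [set: R]) (fun z : M.-tuple R * R => z.2 - lin a z.1).
Proof.
apply: measurable_funB; first exact: measurable_funTS measurable_snd.
apply: (measurable_comp mX) (measurable_linear_fun a) _ => [_ [z [Xz _] <-]//|].
exact: measurable_funTS measurable_fst.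
Qed.

(** Each data point has law [mu], so the [i]-th one can stand in for the fresh draw when the
    coefficients [a] are fixed. All moments thereby become integrals over [Omega]. *)
Lemma lossE i a :
  loss X mu (lin a) = (\int[P]_w (((D w i).2 - lin a (D w i).1) ^+ 2))%:E.
Proof.
have [_ r2] := square_integrable_residual i a.
rewrite -integrable_EFinE//.
have XR w : (X `*` [set: R]) (D w i) by split => //; exact: DX.
exact: (integral_transfer (mD i) XR (@D_law i) (measurableX mX measurableT)
  (measurable_funX 2 (measurable_residual_fun a))).
Qed.

Lemma linear_funB a v x : lin (a - v) x = lin a x - lin v x.
Proof.
by rewrite /linear_fun -sumrB; apply: eq_bigr => k _; rewrite !mxE mulrBl.
Qed.

Section BestApproximation.
Variable astar : 'cV[R]_d.
Hypothesis astar_min : forall a, (loss X mu (lin astar) <= loss X mu (lin a))%E.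
Local Notation r i w := ((D w i).2 - lin astar (D w i).1).

(** Moving [astar] by [t] along the [k]-th coordinate changes the residual by [- t * phi k], and the
    loss cannot decrease. *)
Lemma residual_orthogonal i k : \int[P]_w (r i w * phi k (D w i).1) = 0.
Proof.
apply: (orthogonal_of_minimal (square_integrable_residual i astar)
  (square_integrable_feature i k)) => t.
have := astar_min (astar + t *: delta_mx k 0).
rewrite !(lossE i) lee_fin; congr (_ <= _).
apply: eq_Rintegral => w _; congr (_ ^+ 2).
(* The sum is recast as a difference so that [linear_funB] applies. *)
rewrite -(opprK (t *: _)) linear_funB.
have -> : lin (- (t *: delta_mx k 0)) (D w i).1 = - (t * phi k (D w i).1).
  rewrite /linear_fun (bigD1 k)//= big1 => [|l lk]; rewrite !mxE ?eqxx/=.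
    by rewrite addr0 mulr1 mulNr.
  by rewrite (negPf lk) mulr0 oppr0 mul0r.
by rewrite opprK opprD addrA.
Qed.

(** With [v = a - astar], the residual of [a] is [r - lin v]. In its square the cross term
    integrates to [0] by orthogonality, and the last term gives the form of [C] at [v]. *)
Lemma loss_excess i a : loss X mu (lin a) =
  (\int[P]_w (r i w ^+ 2) + ((a - astar)^T *m C *m (a - astar)) 0 0)%:E.
Proof.
have Lr := square_integrable_residual i astar.
rewrite (lossE i) (second_moment_mx_form i); set v := a - astar.
have Lv := square_integrable_linear_fun i v.
have orth : \int[P]_w (r i w * lin v (D w i).1) = 0.
  have iF k : P.-integrable setT
      (EFin \o (fun w => v k 0 * (r i w * phi k (D w i).1))).
    exact/integrable_EFinZl/square_integrableM/square_integrable_feature.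
  transitivity (\int[P]_w \sum_k v k 0 * (r i w * phi k (D w i).1)).
    apply: eq_Rintegral => w _; rewrite /linear_fun mulr_sumr.
    by apply: eq_bigr => k _; rewrite mulrCA.
  rewrite Rintegral_sum// big1// => k _.
  rewrite RintegralZl//; first by rewrite residual_orthogonal mulr0.
  exact/square_integrableM/square_integrable_feature.
congr EFin; transitivity (\int[P]_w (r i w ^+ 2 +
    ((- 2) * (r i w * lin v (D w i).1) + lin v (D w i).1 ^+ 2))).
  by apply: eq_Rintegral => w _; rewrite linear_funB; ring.
have rv := square_integrableM Lr Lv.
case: Lr Lv => [_ r2] [_ v2].
have rv2 := integrable_EFinZl (- 2) rv.
rewrite RintegralD//; last exact: integrable_EFinD.
by rewrite RintegralD// RintegralZl// orth mulr0 add0r.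
Qed.

(** Both sides are the loss of [astar]. *)
Lemma residual_variance i j : \int[P]_w (r i w ^+ 2) = \int[P]_w (r j w ^+ 2).
Proof. by apply: EFin_inj; rewrite -!lossE. Qed.

Lemma residual_mean i k : (forall x, X x -> phi k x = 1) ->
  \int[P]_w r i w = 0.
Proof.
move=> phik; rewrite -[RHS](residual_orthogonal i k).
by apply: eq_Rintegral => w _; rewrite phik ?mulr1.
Qed.

Lemma residual_independent i j : mutually_independent P (fun i w => D w i) ->
  i != j -> independent P (fun w => r i w) (fun w => r j w).
Proof.
move=> D_indep ij A B mA mB.
pose h (z : M.-tuple R * R) := z.2 - lin astar z.1.
(* The residual function [h] is measurable on [X * R] only, hence the intersection; the data always
   lie there, so no event about them changes. *)
pose E (l : 'I_n) := (X `*` [set: R]) `&` h @^-1` (if l == i then A else B).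
have mE l : measurable (E l).
  apply: (measurable_residual_fun astar) => //; first exact: measurableX.
  by case: ifP.
have EE l : (fun w => D w l) @^-1` E l =
    (fun w => r l w) @^-1` (if l == i then A else B).
  by apply/seteqP; split => [w []//|w hw]; split=> //; split => //; exact: DX.
have := D_indep [set i; j]%SET E mE.
rewrite big_setU1 ?inE//= big_set1 !EE eqxx eq_sym (negPf ij) => <-.
congr (P _); apply/seteqP; split => [w [Aw Bw] l|w Ew] /=.
  rewrite !inE => /orP[] /eqP ->.
    by have : ((fun w => D w i) @^-1` E i) w by rewrite EE eqxx.
  by have : ((fun w => D w j) @^-1` E j) w by rewrite EE eq_sym (negPf ij).
split.
  by have := Ew i; rewrite !inE eqxx => /(_ isT) [_]; rewrite /= eqxx.
by have := Ew j; rewrite !inE eqxx orbT => /(_ isT) [_]; rewrite /= eq_sym (negPf ij).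
Qed.

Lemma residual_covariance i j k : mutually_independent P (fun i w => D w i) ->
  (forall x, X x -> phi k x = 1) ->
  \int[P]_w (r i w * r j w) = (\int[P]_w (r i w ^+ 2)) *+ (i == j).
Proof.
move=> D_indep phik; have [<-|ij] := eqVneq i j.
  by apply: eq_Rintegral => w _; rewrite expr2.
have phi_feat l : square_integrable P (fun w => phi k (D w l).1).
  exact: square_integrable_feature.
(* The residual equals its product with the constant feature, a product of two square integrable
   functions. *)
have ri l : P.-integrable setT (EFin \o (fun w => r l w)).
  have := square_integrableM (square_integrable_residual l astar) (phi_feat l).
  by apply: eq_integrable => // w _ /=; rewrite phik ?mulr1.
rewrite independent_RintegralM//; last exact: residual_independent.
by rewrite (residual_mean _ phik) mul0r.
Qed.

End BestApproximation.
End Moments.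

(** * Least squares in matrix form *)

Lemma empirical_lossE (R : realType) (M n d : nat) (phi : 'I_d -> M.-tuple R -> R)
    (D : 'I_n -> M.-tuple R * R) (a : 'cV[R]_d) (y := \col_i (D i).2) :
  empirical_loss D (linear_fun phi a) =
  n%:R^-1 * ((y - design_mx phi D *m a)^T *m (y - design_mx phi D *m a)) 0 0.
Proof.
rewrite /empirical_loss mxform_norm; congr (_ * _); apply: eq_bigr => i _.
rewrite !mxE; congr ((_ - _) ^+ 2); apply: eq_bigr => k _.
by rewrite mxE mulrC.
Qed.

(** Cancelling the positive factor [1 / n] turns minimality of the empirical loss into minimality of
    a squared norm. *)
Lemma least_squares_ols (R : realType) (M n d : nat) (X : set (M.-tuple R))
    (phi : 'I_d -> M.-tuple R -> R) (alphahat : ('I_n -> M.-tuple R * R) -> 'cV[R]_d)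
    (D : 'I_n -> M.-tuple R * R) : (0 < n)%N ->
  least_squares X phi alphahat -> (forall i, X (D i).1) ->
  gram_mx phi D \in unitmx ->
  alphahat D = ols_mx (design_mx phi D) *m \col_i (D i).2.
Proof.
move=> n0 lsP DX u; apply: minimizer_ols => // v.
have [_ /(_ v I)] := lsP D DX u.
by rewrite !empirical_lossE ler_pM2l ?invr_gt0 ?ltr0n.
Qed.

(** * The two expected losses and their ratio *)

Theorem theorem2 (R : realType) (M n d : nat)
  (d_gt0 : (0 < d)%N) (d_lt_n : (d < n)%N)
  (* input domain, basis functions, with phi_1 = 1 *)
  (X : set (M.-tuple R)) (mX : measurable X)
  (phi : 'I_d -> M.-tuple R -> R)
  (mphi : forall k, measurable_fun X (phi k))
  (phi1 : forall x, X x -> phi (Ordinal d_gt0) x = 1)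
  (* joint law of (x, y), with density p *)
  (mu : probability (M.-tuple R * R)%type R) (p : M.-tuple R * R -> R)
  (mu_p : has_joint_density X mu p)
  (* regression function in L^2 *)
  (fstar : M.-tuple R -> R) (mfstar : measurable_fun X fstar)
  (fstar_L2 : (marginal mu).-integrable X (fun x => (fstar x ^+ 2)%:E))
  (* i.i.d. training data *)
  (dO : measure_display) (Omega : measurableType dO)
  (P : probability Omega R)
  (D : Omega -> 'I_n -> M.-tuple R * R)
  (mD : forall i, measurable_fun [set: Omega] (fun w => D w i))
  (DX : forall w i, X (D w i).1)
  (D_law : forall i (A : set (M.-tuple R * R)%type), measurable A ->
     P [set w | A (D w i)] = mu A)
  (D_indep : mutually_independent P (fun i w => D w i))
  (* additive noise *)
  (sigma : R) (xi : 'I_n -> {RV P >-> R})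
  (D_xi : forall w i, (D w i).2 = fstar (D w i).1 + xi i w)
  (xi_L2 : forall i, P.-integrable [set: Omega] (fun w => (xi i w ^+ 2)%:E))
  (xi_mean : forall i, ('E_P[xi i] = 0)%E)
  (xi_var : forall i, ('V_P[xi i] = (sigma ^+ 2)%:E)%E)
  (xi_indep : forall i, independent P (fun w => (D w i).1) (xi i))
  (* least squares estimator, almost surely well defined *)
  (gram_unit : {ae P, forall w, gram_mx phi (D w) \in unitmx})
  (alphahat : ('I_n -> M.-tuple R * R) -> 'cV[R]_d)
  (alphahatP : least_squares X phi alphahat)
  (* all expectations are finite *)
  (C_fin : forall k k',
     (marginal mu).-integrable X (fun x => (phi k x * phi k' x)%:E))
  (loss_fin : P.-integrable [set: Omega]
     (fun w => loss X mu (linear_fun phi (alphahat (D w)))))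
  (empirical_loss_fin : P.-integrable [set: Omega]
     (fun w => (empirical_loss (D w) (linear_fun phi (alphahat (D w))))%:E))
  (trace_fin : P.-integrable [set: Omega]
     (fun w => (\tr (second_moment_mx X phi mu *m
                     invmx (empirical_second_moment_mx phi (D w))))%:E))
  (denominator_neq0 : fine (expected_empirical_loss phi P D alphahat) != 0)
  (* best approximation in the model *)
  (fdstar : M.-tuple R -> R)
  (fdstarP : argmin (linear_model X phi) (loss X mu) fdstar)
  (residual_indep : independent P
     (fun w => residual fdstar (D w) : measurable_mx R n 1)
     (fun w => design_mx phi (D w) : measurable_mx R n d)) :
  loss_ratio X phi P mu D alphahat =
    (1 + n%:R^-1 * fine (expected_trace X phi P mu D)) / (1 - d%:R / n%:R).
Proof.
have n_gt0 : (0 < n)%N by apply: leq_ltn_trans d_lt_n.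
have n_neq0 : n%:R != 0 :> R by rewrite pnatr_eq0 -lt0n.
pose i0 := Ordinal n_gt0.
(* [fdstar] agrees with the linear function of [astar] on [X], where both the loss and the data
   live. *)
have [[astar fdstarE] fdstar_min] := fdstarP.
have loss_fdstar : loss X mu fdstar = loss X mu (linear_fun phi astar).
  by apply: eq_integral => z; rewrite inE => -[Xz _]; rewrite fdstarE.
have astar_min a :
    (loss X mu (linear_fun phi astar) <= loss X mu (linear_fun phi a))%E.
  by rewrite -loss_fdstar; apply: fdstar_min; exists a.
have y_L2 i : square_integrable P (fun w => (D w i).2).
  under eq_fun do rewrite D_xi; apply: square_integrableD.
    split.
      exact: (measurable_transfer (f := fstar) (measurable_input mD i) (DX^~ i) mX).
    exact: (@marginal_integrable _ _ _ _ mX _ _ _ _ _ mD DX D_law i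
      (fun x => fstar x ^+ 2) (measurable_funX 2 mfstar)).
  by split; [exact: measurable_funP|exact: xi_L2].
pose C := second_moment_mx X phi mu.
pose Phi w := design_mx phi (D w).
pose r w := residual fdstar (D w).
have rE w i : r w i 0 = (D w i).2 - linear_fun phi astar (D w i).1.
  by rewrite mxE fdstarE.
have yE w : \col_i (D w i).2 = Phi w *m astar + r w.
  apply/colP => i; rewrite 2!mxE [RHS]addrC rE mxE /linear_fun.
  rewrite [X in _ - _ + X](_ : _ = \sum_k astar k 0 * phi k (D w i).1) ?subrK//.
  by apply: eq_bigr => k _; rewrite mxE mulrC.
have ri i : square_integrable P (fun w => r w i 0).
  under eq_fun do rewrite rE.
  exact: (square_integrable_residual mX mphi mD DX D_law C_fin y_L2).
set s2 := \int[P]_w (r w i0 0 ^+ 2).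
have rcov i j : \int[P]_w (r w i 0 * r w j 0) = s2 *+ (i == j).
  under eq_Rintegral do rewrite !rE.
  rewrite (residual_covariance mX mphi mD DX D_law C_fin y_L2 astar_min
    i j D_indep phi1).
  rewrite (residual_variance mX mphi mD DX D_law C_fin y_L2 astar i i0).
  by congr (_ *+ _); apply: eq_Rintegral => w _; rewrite rE.
have Csym : C^T = C by exact: second_moment_mx_sym.
have Cpsd (v : 'cV[R]_d) : 0 <= (v^T *m C *m v) 0 0.
  exact: (second_moment_mx_psd mX mphi mD DX D_law C_fin i0).
have mPhi : measurable_entries Phi.
  move=> i k; under eq_fun do rewrite mxE.
  exact: (measurable_feature mX mphi mD DX).
pose trC w := \tr (C *m invmx (empirical_second_moment_mx phi (D w))).
(* The factor [1 / n] arises because the inverse of the empirical second moment matrix is [n] times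
   the inverse Gram matrix. *)
have trC_error w : gram_mx phi (D w) \in unitmx ->
    \tr (error_mx (Phi w) C) = n%:R^-1 * trC w.
  move=> u; rewrite error_mx_trace// /trC /empirical_second_moment_mx.
  rewrite invmxZ; last by rewrite unitmxZ// unitfE invr_eq0.
  by rewrite invrK -scalemxAr mxtraceZ mulKf.
(* The bound by the trace holds at every [w], as [error_mx] is [0] where the Gram matrix is
   singular. *)
have Ei i j : P.-integrable setT (EFin \o (fun w => error_mx (Phi w) C i j)).
  apply: le_integrable_EFin (integrable_EFinZl n%:R^-1 trace_fin).
    exact: measurable_error_mx.
  move=> w; apply: le_trans (error_mx_entry_le _ Csym Cpsd i j) _.
  have [u|u] := boolP (gram_mx phi (D w) \in unitmx).
    by rewrite trC_error// ler_norm.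
  by rewrite /error_mx ols_mx_singular// mulmx0 mxtrace0.
pose A2 (N : 'M[R]_(n, d)) := 1%:M - hat_mx N.
(* The general source [T] serves two uses: [Phi] on [Omega], and the identity on the space of
   matrices. *)
have mA2 dT (T : measurableType dT) (F : T -> 'M[R]_(n, d)) :
    measurable_entries F -> measurable_entries (fun w => A2 (F w)).
  move=> mF i j; under eq_fun do rewrite 3!mxE.
  by apply: measurable_funB => //; exact: measurable_hat_mx.
have A2i i j : P.-integrable setT (EFin \o (fun w => A2 (Phi w) i j)).
  apply: (le_integrable_EFin (g := cst (1 + d%:R))).
  - exact: mA2.
  - move=> w; rewrite [leRHS]ger0_norm; last by rewrite addr_ge0.
    rewrite 3!mxE; apply: le_trans (ler_normB _ _) _.
    apply: lerD; last exact: hat_mx_entry_le.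
    by case: (i == j); rewrite ?normr1 ?normr0.
  - exact: finite_measure_integrable_cst.
have mE : measurable_entries
    ((fun N => error_mx N C) : measurable_mx R n d -> 'M[R]_n).
  apply: (@measurable_error_mx _ _ (measurable_mx R n d)).
  exact: measurable_entries_id.
have mA2' : measurable_entries (A2 : measurable_mx R n d -> 'M[R]_n).
  by apply: (mA2 _ (measurable_mx R n d)); exact: measurable_entries_id.
have lossE : expected_loss X phi P mu D alphahat =
    (s2 * (1 + n%:R^-1 * fine (expected_trace X phi P mu D)))%:E.
  pose g w := s2 + ((r w)^T *m error_mx (Phi w) C *m r w) 0 0.
  have gi1 := integrable_mxform residual_indep mE Ei ri.
  have ci : P.-integrable setT (EFin \o (fun _ : Omega => s2)).
    exact: finite_measure_integrable_cst.
  have gi : P.-integrable setT (EFin \o g) by exact: integrable_EFinD.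
  transitivity (\int[P]_w (g w)%:E)%E.
    apply: ae_eq_integral => //.
    - by case/integrableP: loss_fin.
    - by case/integrableP: gi.
    apply: filterS gram_unit => w u _ /=.
    (* Substituting [y = Phi astar + r] gives the estimator as [astar + ols_mx Phi *m r]. *)
    rewrite (least_squares_ols n_gt0 alphahatP (DX w) u) -/(Phi w) yE.
    rewrite mulmxDr ols_mxK//.
    rewrite (loss_excess mX mphi mD DX D_law C_fin y_L2 astar_min i0).
    rewrite [astar + _]addrC addrK.
    rewrite /g error_mx_form; congr (_ + _)%:E.
    by apply: eq_Rintegral => w' _; rewrite rE.
  rewrite integrable_EFinE// /g RintegralD// Rintegral_cst_probability.
  rewrite (Rintegral_mxform residual_indep mE Ei ri rcov).
  rewrite mulrDr mulr1; congr (_ + s2 * _)%:E.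
  rewrite -RintegralZl//.
  apply: ae_eq_Rintegral.
  - exact/measurable_mxtrace/measurable_error_mx.
  - by case/integrableP: trace_fin => /measurable_EFinP mt _; exact: measurable_funM.
  by apply: filterS gram_unit => w u _; exact: trC_error.
have empE : expected_empirical_loss phi P D alphahat =
    (n%:R^-1 * (s2 * (n%:R - d%:R)))%:E.
  pose g w := n%:R^-1 * ((r w)^T *m A2 (Phi w) *m r w) 0 0.
  have gi1 := integrable_mxform residual_indep mA2' A2i ri.
  have gi : P.-integrable setT (EFin \o g) by exact: integrable_EFinZl.
  transitivity (\int[P]_w (g w)%:E)%E.
    apply: ae_eq_integral => //.
    - by case/integrableP: empirical_loss_fin.
    - by case/integrableP: gi.
    apply: filterS gram_unit => w u _ /=.
    rewrite empirical_lossE (least_squares_ols n_gt0 alphahatP (DX w) u).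
    rewrite -/(Phi w) yE.
    (* The part [Phi astar] of [y] is fitted exactly, so the in-sample residuals depend on [r]
       alone. *)
    have -> : Phi w *m astar + r w -
        Phi w *m (ols_mx (Phi w) *m (Phi w *m astar + r w)) = r w - hat_mx (Phi w) *m r w.
      rewrite [ols_mx _ *m (_ + _)]mulmxDr ols_mxK// [Phi w *m (_ + _)]mulmxDr.
      by rewrite opprD addrACA subrr add0r mulmxA.
    by rewrite ols_residual_norm.
  rewrite integrable_EFinE// /g RintegralZl//.
  rewrite (Rintegral_mxform residual_indep mA2' A2i ri rcov).
  congr (_ * (_ * _))%:E.
  transitivity (\int[P]_w (cst (n%:R - d%:R : R) w)); last first.
    exact: Rintegral_cst_probability.
  apply: ae_eq_Rintegral => //; first exact/measurable_mxtrace/mA2.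
  apply: filterS gram_unit => w u _.
  by rewrite /A2 linearB/= mxtrace1 hat_mx_trace.
rewrite /loss_ratio lossE empE /=.
have nd : n%:R - d%:R != 0 :> R by rewrite subr_eq0 eqr_nat gtn_eqF.
(* The nonzero denominator forces [s2 != 0], so that [s2] cancels in the ratio. *)
have : n%:R^-1 * (s2 * (n%:R - d%:R)) != 0 by rewrite empE in denominator_neq0.
rewrite mulf_eq0 invr_eq0 (negPf n_neq0) mulf_eq0 (negPf nd) orbF /= => s2_neq0.
by field; rewrite n_neq0 nd s2_neq0.
Qed.
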